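(* Let $d\ge2$ and let $(V,E)$ be the Cayley tree of order $d$. Then there exists $\beta_c(d)\in(0,\infty)$ such that for all $\beta>\beta_c(d)$ there exists a time $t_c(\beta,d)\in(0,\infty)$ such that the time-evolved intermediate measure $\mu^{\#}_{\beta,\lambda,t}$ is not a Gibbs measure (i.e. it is not compatible with any quasilocal specification) for all $t\ge t_c(\beta,d)$ and all activities $\lambda>0$.
   Context: The Cayley tree of order $d$ is the infinite tree $(V,E)$ in which each vertex has exactly $d+1$ neighbours. $\Omega=\{-1,0,1\}^V$ carries the product $\sigma$-algebra $\mathcal F$ and product topology; $\sigma_\Lambda$ denotes the restriction map $\omega\mapsto\omega_\Lambda=(\omega_i)_{i\in\Lambda}$, $\mathcal F_\Lambda$ the $\sigma$-algebra generated by $\sigma_\Lambda$, and $\Lambda\Subset V$ means $\Lambda$ is a finite subset. A specification is a family $\gamma=(\gamma_\Lambda)_{\Lambda\Subset V}$ of probability kernels $\gamma_\Lambda$ from $\mathcal F_{\Lambda^c}$ to $\mathcal F$ with $\gamma_\Lambda(A\mid\cdot)=1_A$ for $A\in\mathcal F_{\Lambda^c}$ and $\gamma_\Delta\gamma_\Lambda=\gamma_\Delta$ for $\Lambda\subset\Delta\Subset V$. It is quasilocal if each $\gamma_\Lambda$ maps quasilocal functions to quasilocal functions, where a function is quasilocal if it is a uniform limit of local functions ($\mathcal F_\Lambda$-measurable for some $\Lambda\Subset V$), equivalently continuous in the product topology. A probability measure $\mu$ is compatible with $\gamma$ if $\mu=\mu\gamma_\Lambda$ for all $\Lambda\Subset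 V$; $\mu$ is a Gibbs measure if it is compatible with some quasilocal specification. Soft-core Widom-Rowlinson model (zero magnetic field), $\beta>0$ (repulsion), $\lambda>0$ (activity): the specification $$\gamma_\Lambda(\sigma_\Lambda=\omega_\Lambda\mid\eta_{\Lambda^c})=\frac1{Z_\Lambda(\eta_{\Lambda^c})}\exp\Big(-\beta\sum_{\{i,j\}\in E,\{i,j\}\cap\Lambda\ne\emptyset}1_{\{\tilde\omega_i\tilde\omega_j=-1\}}\Big)\prod_{i\in\Lambda}\lambda^{\omega_i^2},\qquad \tilde\omega=\omega_\Lambda\eta_{\Lambda^c}.$$ A probability measure $\mu$ on $\Omega$ is a tree-indexed Markov chain if for each oriented edge $ij$ one has $\mu(\sigma_j=x\mid\mathcal F_{(-\infty,ij)})=\mu(\sigma_j=x\mid\mathcal F_{\{i\}})$ $\mu$-a.s. for all $x$, where $(-\infty,ij)$ is the set of vertices $k$ whose self-avoiding path to $i$ does not contain $j$. The intermediate measure $\mu^{\#}_{\beta,\lambda}$ is the unique Gibbs measure of the model that is a tree-indexed Markov chain, invariant under all tree automorphisms, and invariant under the spin flip $\omega\mapsto-\omega$. Concretely, let $\xi=\xi_{\beta,\lambda}$ be the unique positive solution of $x=\lambda\big(\frac{1+(1+e^{-\beta})x}{1+2x}\big)^d$; then $\mu^{\#}_{\beta,\lambda}$ is the homogeneous tree-indexed Markov chain with transition matrix $P$ given by $P(s,s)=\frac{\xi}{1+(1+e^{-\beta})\xi}$, $P(s,-s)=\frac{e^{-\beta}\xi}{1+(1+e^{-\beta})\xi}$,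 $P(s,0)=\frac{1}{1+(1+e^{-\beta})\xi}$ for $s\in\{-1,1\}$, $P(0,\pm1)=\frac{\xi}{1+2\xi}$, $P(0,0)=\frac1{1+2\xi}$, with the $P$-invariant distribution as single-site marginal. Time evolution: for $t\ge0$, $\mu_t$ is the image of $\mu$ under the product kernel that acts independently at each site by $$p_t(\omega,\eta)=\tfrac12(1+e^{-2t})1_{\{\omega=\eta\ne0\}}+\tfrac12(1-e^{-2t})1_{\{\omega\eta=-1\}}+1_{\{\omega=\eta=0\}},\qquad \omega,\eta\in\{-1,0,1\}.$$ $\mu^{\#}_{\beta,\lambda,t}$ is the time-evolved measure started from $\mu^{\#}_{\beta,\lambda}$. *)

(* Defs.v *)
From HB Require Import structures.
From mathcomp Require Import all_boot all_order all_algebra finmap.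
From mathcomp Require Import all_classical all_reals all_analysis.

Set Implicit Arguments.
Unset Strict Implicit.
Unset Printing Implicit Defensive.

Import Order.TTheory GRing.Theory Num.Theory.
Import numFieldNormedType.Exports.

Local Open Scope classical_set_scope.
Local Open Scope ring_scope.

Inductive spin := spin_neg | spin_zero | spin_pos.

Definition spin_val (s : spin) : int :=
  match s with spin_neg => -1 | spin_zero => 0 | spin_pos => 1 end.

Definition spin_opp (s : spin) : spin :=
  match s with spin_neg => spin_pos | spin_zero => spin_zero | spin_pos => spin_neg end.

Definition spin_to_ord (s : spin) : 'I_3 :=
  match s with spin_neg => inord 0 | spin_zero => inord 1 | spin_pos => inord 2 end.

Definition ord_to_spin (i : 'I_3) : spin :=
  match val i with 0%N => spin_neg | 1%N => spin_zero | _ => spin_pos end.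

Lemma spin_to_ordK : cancel spin_to_ord ord_to_spin.
Proof. by case; rewrite /ord_to_spin /spin_to_ord /= inordK. Qed.

HB.instance Definition _ := Finite.copy spin (can_type spin_to_ordK).
HB.instance Definition _ := isPointed.Build spin spin_zero.

(* The Cayley tree of order [d]: an infinite (d+1)-regular tree with edge
   relation [e], a tree being a graph with exactly one self-avoiding path
   between any two vertices. *)

Definition self_avoiding (V : eqType) (e : rel V) (x y : V) (p : seq V) :=
  [/\ path e x p, uniq (x :: p) & last x p = y].

Definition cayley_tree (V : choiceType) (e : rel V) (d : nat) : Prop :=
  [/\ symmetric e, irreflexive e,
      forall x y, exists! p, self_avoiding e x y p,
      infinite_set [set: V]
    & forall x, ([set y | e x y] #= `I_d.+1)%card].

Definition tree_automorphism (V : choiceType) (e : rel V) (phi : V -> V) :=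
  bijective phi /\ forall i j, e (phi i) (phi j) = e i j.

(* The past of the oriented edge ij. *)
Definition past (V : choiceType) (e : rel V) (i j : V) : set V :=
  [set k | exists2 p, self_avoiding e k i p & j \notin k :: p].

Definition edges (V : choiceType) (e : rel V) : set {fset V} :=
  [set E | exists i j, e i j /\ E = [fset i; j]%fset].

(* [Omega D] is the set of all configurations on [V], equipped with the
   sigma-algebra F_D generated by the coordinates in [D].  The underlying type
   does not depend on [D]; [Config V] carries the full product sigma-algebra. *)

Definition coords (V : choiceType) (D : set V) : set (set (V -> spin)) :=
  [set A | exists2 i, D i & exists x, A = [set w | w i = x]].

Notation Omega D := (g_sigma_algebraType (coords D)).
Notation Config V := (Omega [set: V]).

Definition cylinder (V : choiceType) (L : {fset V}) (tau : {ffun L -> spin}) :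
  set (V -> spin) := [set w | forall i : L, w (val i) = tau i].

Definition glue_config (V : choiceType) (L : {fset V}) (tau : {ffun L -> spin})
  (eta : V -> spin) : V -> spin := fun i => oapp tau (eta i) (insub i).

Section Specifications.
Context (R : realType) (V : choiceType).

Definition kernel_family :=
  forall L : {fset V}, R.-pker (Omega (~` [set` L])) ~> (Config V).

Definition proper_kernels (gamma : kernel_family) : Prop :=
  forall (L : {fset V}) (A : set (Omega (~` [set` L]))), measurable A ->
  forall eta, gamma L eta A = (\1_A eta)%:E.

Definition consistent (gamma : kernel_family) : Prop :=
  forall L D : {fset V}, (L `<=` D)%fset ->
  forall eta (A : set (Config V)), measurable A ->
  (\int[gamma D eta]_w gamma L w A = gamma D eta A)%E.

Definition specification (gamma : kernel_family) : Prop :=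
  proper_kernels gamma /\ consistent gamma.

Definition local (f : (V -> spin) -> R) : Prop :=
  exists L : {fset V},
    measurable_fun [set: Omega [set` L]] (f : Omega [set` L] -> R).

Definition quasilocal (f : (V -> spin) -> R) : Prop :=
  forall eps : R, 0 < eps ->
  exists2 g, local g & forall w, `|f w - g w| < eps.

Definition quasilocal_spec (gamma : kernel_family) : Prop :=
  forall (L : {fset V}) f, quasilocal f ->
  quasilocal (fun eta => Rintegral (gamma L eta) setT f).

Definition compatible (mu : probability (Config V) R) (gamma : kernel_family) :
  Prop :=
  forall (L : {fset V}) (A : set (Config V)), measurable A ->
  (mu A = \int[mu]_eta gamma L eta A)%E.

Definition gibbs_measure (mu : probability (Config V) R) : Prop :=
  exists gamma : kernel_family,
    [/\ specification gamma, quasilocal_spec gamma & compatible mu gamma].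

End Specifications.

Section WidomRowlinson.
Context (R : realType) (V : choiceType) (e : rel V) (beta lambda : R).

(* The number of edges {i, j} meeting [L] with w_i w_j = -1.  The endpoints of
   an edge E enter through all pairs in E x E; the diagonal pairs never
   contribute. *)
Definition repulsions (L : {fset V}) (w : V -> spin) : R :=
  \sum_(E \in [set E | edges e E /\ exists2 i, i \in E & i \in L])
    ([exists i : E, exists j : E,
        spin_val (w (val i)) * spin_val (w (val j)) == -1]%:R : R).

Definition weight (L : {fset V}) (tau : {ffun L -> spin}) (eta : V -> spin) : R :=
  expR (- beta * repulsions L (glue_config tau eta)) *
  \prod_(i : L) lambda ^ (spin_val (tau i) ^+ 2).

Definition partition_function (L : {fset V}) (eta : V -> spin) : R :=
  \sum_(tau : {ffun L -> spin}) weight tau eta.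

Definition wr_specification (gamma : kernel_family R V) : Prop :=
  specification gamma /\
  forall (L : {fset V}) (tau : {ffun L -> spin}) (eta : V -> spin),
    gamma L eta (cylinder tau) =
    ((partition_function L eta)^-1 * weight tau eta)%:E.

Definition wr_gibbs_measure (mu : probability (Config V) R) : Prop :=
  exists2 gamma, wr_specification gamma & compatible mu gamma.

End WidomRowlinson.

Section MarkovChains.
Context (R : realType) (V : choiceType) (e : rel V).
Implicit Type mu : probability (Config V) R.

(* [f] is a version of the conditional probability mu(B | F_D). *)
Definition cond_prob mu (D : set V) (B : set (Config V))
  (f : (V -> spin) -> R) : Prop :=
  [/\ measurable_fun [set: Omega D] (f : Omega D -> R),
      mu.-integrable setT (EFin \o f)
    & forall C : set (Omega D), measurable C ->
        (\int[mu]_(w in (C : set (Config V))) (f w)%:E = mu (B `&` C))%E].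

Definition tree_markov_chain mu : Prop :=
  forall i j, e i j -> forall x : spin,
  exists f g, [/\ cond_prob mu (past e i j) [set w : V -> spin | w j = x] f,
                  cond_prob mu [set i] [set w : V -> spin | w j = x] g
                & {ae mu, forall w, f w = g w}].

Definition automorphism_invariant mu : Prop :=
  forall phi, tree_automorphism e phi ->
  forall A : set (Config V), measurable A ->
  mu [set w : V -> spin | A (w \o phi)] = mu A.

Definition flip_invariant mu : Prop :=
  forall A : set (Config V), measurable A ->
  mu [set w : V -> spin | A (spin_opp \o w)] = mu A.

Definition intermediate_measure (beta lambda : R) mu : Prop :=
  [/\ wr_gibbs_measure e beta lambda mu, tree_markov_chain mu,
      automorphism_invariant mu & flip_invariant mu].

End MarkovChains.

Section TimeEvolution.
Context (R : realType) (V : choiceType) (t : R).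

Definition site_kernel (a b : spin) : R :=
  2^-1 * (1 + expR (- (2 * t))) * ((a == b) && (b != spin_zero))%:R +
  2^-1 * (1 - expR (- (2 * t))) * (spin_val a * spin_val b == -1)%:R +
  ((a == spin_zero) && (b == spin_zero))%:R.

(* K(w, .) is the product over the sites i of the measures p_t(w_i, .). *)
Definition product_kernel (K : R.-pker (Config V) ~> (Config V)) : Prop :=
  forall (w : V -> spin) (L : {fset V}) (tau : {ffun L -> spin}),
    K w (cylinder tau) = (\prod_(i : L) site_kernel (w (val i)) (tau i))%:E.

Definition time_evolved (mu nu : probability (Config V) R) : Prop :=
  exists2 K, product_kernel K &
    forall A : set (Config V), measurable A -> (nu A = \int[mu]_w K w A)%E.

End TimeEvolution.

(* Main.v *)
Require Import Defs.
From HB Require Import structures.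
From mathcomp Require Import all_boot all_order all_algebra finmap.
From mathcomp Require Import all_classical all_reals all_analysis.
From mathcomp Require Import measurable_realfun zify ring lra.

Set Implicit Arguments.
Unset Strict Implicit.
Unset Printing Implicit Defensive.

Import Order.TTheory GRing.Theory Num.Theory.
Import numFieldNormedType.Exports.

Local Open Scope classical_set_scope.
Local Open Scope ring_scope.

(**
The time evolution preserves zeros, so pinning the evolved configuration to 0 on
a sphere also pins the initial one there, and zeros do not interact: by the Gibbs
property of the initial measure, given nonzero evolved spins on
the ball inside, the initial spins form an Ising model with free boundary
condition on the ball, whose activities are a constant factor and in which the
evolved configuration acts as a small external field.

Let the evolved configuration be plus on a ball and constant, plus or minus, on a
thick annulus around it.  In the first case the root prefers plus.  In the second
case the minus field drives the odds plus:minus below 1/9 across the annulus, and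
for q = exp(-beta) <= 1/9 and field odds at most 2 the recursion
x |-> 2 ((x + q) / (1 + q x))^2 maps [0, 1/9] into itself, so the plus field of
the inner ball cannot undo this, however large the ball is.  Hence the conditional
law of the evolved root spin depends, by a fixed amount, on spins arbitrarily far
away, whereas a quasilocal kernel is uniformly close to local functions.

The condition on q holds for beta >= 8 and the one on the field for t >= 1.
*)

(** * Sums over configurations *)

Lemma sum_spin (R : nmodType) (F : spin -> R) :
  \sum_x F x = F spin_neg + F spin_zero + F spin_pos.
Proof.
have h : perm_eq (index_enum spin) [:: spin_neg; spin_zero; spin_pos].
  apply: uniq_perm; first exact: index_enum_uniq.
    by rewrite /= !inE !negb_or -!andbA; apply/and4P; split=> //; apply/eqP.
  by case; rewrite mem_index_enum !inE eqxx ?orbT.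
by rewrite (perm_big _ h) /= !big_cons big_nil addr0 addrA.
Qed.

Section ConfigurationSums.
Context (R : pzRingType) (V : choiceType).
Implicit Types (s : seq V) (w : V -> spin) (G : (V -> spin) -> R).

Definition upd w v (x : spin) : V -> spin := fun u => if u == v then x else w u.

Lemma updE w v x : upd w v x v = x.
Proof. by rewrite /upd eqxx. Qed.

Lemma upd_neq w v x u : u != v -> upd w v x u = w u.
Proof. by rewrite /upd => /negbTE ->. Qed.

Lemma upd_id w v : upd w v (w v) = w.
Proof. by apply/funext => u; rewrite /upd; case: eqP => [->|]. Qed.

Lemma upd_notin w s v x : v \notin s -> forall u, u \in s -> upd w v x u = w u.
Proof. by move=> vs u us; apply: upd_neq; apply: contraNneq vs => <-. Qed.

(* The sum of [G] over all configurations that coincide with [w] off [s]. *)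
Fixpoint cfg_sum s G w : R :=
  if s is v :: s' then \sum_x cfg_sum s' G (upd w v x) else G w.

Lemma cfg_sum_cat s1 s2 G w :
  cfg_sum (s1 ++ s2) G w = cfg_sum s1 (cfg_sum s2 G) w.
Proof. by elim: s1 w => //= v s1 IH w; apply: eq_bigr => x _; exact: IH. Qed.

Lemma eq_cfg_sum s G G' w :
  (forall w', (forall u, u \notin s -> w' u = w u) -> G w' = G' w') ->
  cfg_sum s G w = cfg_sum s G' w.
Proof.
elim: s w => [|v s IH] w h /=; first exact: h.
apply: eq_bigr => x _; apply: IH => w' hw'; apply: h => u.
by rewrite inE negb_or => /andP[uv us]; rewrite hw' // upd_neq.
Qed.

Lemma mulr_cfg_sumr s G w c : cfg_sum s (fun w' => c * G w') w = c * cfg_sum s G w.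
Proof.
by elim: s w => //= v s IH w; rewrite mulr_sumr; apply: eq_bigr => x _.
Qed.

End ConfigurationSums.

(** [g] also takes the whole configuration, so that a factor may involve spins off [s], such as the
    one at the parent. Since it ignores those on [s], the sites can be summed out one after
    another. *)
Lemma cfg_sum_prod (R : comPzRingType) (V : choiceType) (s : seq V)
    (H : (V -> spin) -> R) (g : V -> (V -> spin) -> spin -> R) w :
  uniq s ->
  (forall w v x, v \in s -> H (upd w v x) = H w) ->
  (forall u w v x, u \in s -> v \in s -> g u (upd w v x) = g u w) ->
  cfg_sum s (fun w' => H w' * \prod_(v <- s) g v w' (w' v)) w =
  H w * \prod_(v <- s) \sum_x g v w x.
Proof.
elim: s H w => [|v s IH] H w /=; first by rewrite !big_nil.
move=> /andP[vs us] hH hg; rewrite big_cons mulrCA mulr_suml.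
apply: eq_bigr => x _.
under eq_cfg_sum => w' hw' do rewrite big_cons mulrA (hw' v vs) updE.
rewrite (IH (fun w' => H w' * g v w' x)) //; first last.
- by move=> u w' v' x' us' vs'; apply: hg; rewrite inE ?us' ?vs' orbT.
- by move=> w' u y u_s; rewrite hH ?hg // ?mem_head // inE u_s orbT.
rewrite hH ?mem_head // hg ?mem_head // -mulrA mulrCA; congr (_ * (_ * _)).
apply: eq_big_seq => u u_s.
by apply: eq_bigr => y _; rewrite hg // ?mem_head // inE u_s orbT.
Qed.

(** * Events and integrals on configuration space *)

Section ConfigurationMeasurability.
Context (V : choiceType).
Implicit Types (s : seq V) (w : V -> spin) (D : set V).

Definition agree s w : set (V -> spin) :=
  [set w' | forall v, v \in s -> w' v = w v].

Lemma agree_cons v s w :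
  agree (v :: s) w = agree s w `&` [set w' | w' v = w v].
Proof.
apply/seteqP; split => w' /=.
  by move=> h; split=> [u us|]; apply: h; rewrite inE ?us ?orbT ?eqxx.
by case=> h hv u; rewrite inE => /orP[/eqP->|]; [|exact: h].
Qed.

Lemma measurable_coord D v x : D v ->
  measurable ([set w | w v = x] : set (Omega D)).
Proof. by move=> Dv; apply: sub_sigma_algebra; exists v => //; exists x. Qed.

Lemma measurable_agree D s w : (forall v, v \in s -> D v) ->
  measurable (agree s w : set (Omega D)).
Proof.
elim: s => [|v s IH] h.
  by rewrite (_ : agree [::] w = setT) //; apply/seteqP; split.
rewrite agree_cons; apply: measurableI.
  by apply: IH => u us; apply: h; rewrite inE us orbT.
by apply: measurable_coord; apply: h; rewrite mem_head.
Qed.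

(** The sets that do not separate [w] from [w'] form a sigma-algebra, and it contains the generators
    of F_D. *)
Lemma measurable_Omega_dep D (A : set (Omega D)) w w' : measurable A ->
  (forall v, D v -> w v = w' v) -> A w -> A w'.
Proof.
move=> mA hD; suff : A w <-> A w' by case.
move: A mA; apply: (@smallest_sub _ (sigma_algebra setT) _
  [set A : set (V -> spin) | A w <-> A w']).
  split => [|A|F hF] /=; first by [].
    by rewrite /setD /=; tauto.
  by split=> -[i _ Fi]; exists i => //; apply/(hF i).
by move=> A [v Dv [x ->]] /=; rewrite hD.
Qed.

Lemma measurable_fun_Omega_dep D d (T : measurableType d) (f : (V -> spin) -> T)
    w w' : (forall y : T, measurable [set y]) ->
  measurable_fun [set: Omega D] (f : Omega D -> T) ->
  (forall v, D v -> w v = w' v) -> f w = f w'.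
Proof.
move=> m1 mf hD; have := mf measurableT [set f w] (m1 _); rewrite setTI => mA.
by symmetry; apply: (measurable_Omega_dep mA hD).
Qed.

Lemma measurable_Omega_subset D (A : set (V -> spin)) :
  measurable (A : set (Omega D)) -> measurable (A : set (Config V)).
Proof.
by apply: sub_sigma_algebra2 => _ [v Dv [x ->]]; exists v => //; exists x.
Qed.

Lemma measurable_fun_Omega_subset D d (T : measurableType d)
    (f : (V -> spin) -> T) :
  measurable_fun [set: Omega D] (f : Omega D -> T) ->
  measurable_fun [set: Config V] (f : Config V -> T).
Proof.
move=> mf _ B mB; rewrite setTI; apply: (@measurable_Omega_subset D).
by rewrite -[X in measurable X]setTI; exact: mf.
Qed.

(** Sums and inductions below run over lists; this passes from them to the finite sets that index
    kernels and cylinders. *)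
Definition fset_of s : {fset V} := [fset x in s]%fset.

Lemma mem_fset_of s v : (v \in fset_of s) = (v \in s).
Proof. by rewrite !inE. Qed.

Definition restrict s w : {ffun fset_of s -> spin} := [ffun i => w (val i)].

Lemma cylinder_restrict s w : cylinder (restrict s w) = agree s w.
Proof.
apply/seteqP; split => w' /= h.
  move=> v vs; have vL : v \in fset_of s by rewrite mem_fset_of.
  by have := h [` vL]%fset; rewrite ffunE.
by move=> i; rewrite ffunE; apply: h; rewrite -mem_fset_of (valP i).
Qed.

Lemma prod_fset_of (R : comPzRingType) s (F : V -> R) : uniq s ->
  \prod_(i : fset_of s) F (val i) = \prod_(i <- s) F i.
Proof.
move=> us; rewrite -(big_seq_fsetE _ _ predT F) /=; apply: perm_big.
by apply: uniq_perm => // v; rewrite mem_fset_of.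
Qed.

End ConfigurationMeasurability.

(** * Integrals of products of single-site functions *)

Section IntegralDecomposition.
Context (R : realType) (V : choiceType).
Variable mu : probability (Config V) R.
Implicit Types (s : seq V) (w : V -> spin).

Lemma measurable_fun_coord (h : spin -> R) v :
  measurable_fun [set: Config V] (fun w : Config V => h (w v)).
Proof.
move=> _ B mB; rewrite setTI.
rewrite (_ : _ @^-1` _ = \bigcup_(x in [set x | B (h x)]) [set w | w v = x]).
  by apply: fin_bigcup_measurable => // x _; exact: measurable_coord.
apply/seteqP; split => [w Bw|w [x /= Bx wx]]; first by exists (w v).
by rewrite /preimage /= wx.
Qed.

Lemma measurable_fun_prod_coord s (g : V -> spin -> R) :
  measurable_fun [set: Config V]
    (fun w : Config V => \prod_(v <- s) g v (w v)).
Proof.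
by apply: measurable_prod => v _; exact: measurable_fun_coord.
Qed.

(** Induction on [s]: splitting [B] by the spin at the first site makes the factor of that site
    constant on each piece. This is why [B] is arbitrary. *)
Lemma integral_prod_coord s (g : V -> spin -> R) (B : set (Config V)) w0 :
  uniq s -> (forall v x, 0 <= g v x) -> measurable B ->
  (\int[mu]_(w in B) (\prod_(v <- s) g v (w v))%:E =
   (cfg_sum s (fun w => \prod_(v <- s) g v (w v) *
                        fine (mu (B `&` agree s w))) w0)%:E)%E.
Proof.
move=> + g0; elim: s B w0 => [|v s IH] B w0 /=.
  move=> _ mB; under eq_integral do rewrite big_nil.
  rewrite integral_cst // mul1e big_nil mul1r.
  rewrite (_ : agree [::] w0 = setT) ?setIT ?fineK ?fin_num_measure //.
  by apply/seteqP; split.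
move=> /andP[vs us] mB.
have mBx x : measurable (B `&` [set w | w v = x]).
  by apply: measurableI => //; exact: measurable_coord.
have BE : B = \big[setU/set0]_(x <- index_enum spin) (B `&` [set w | w v = x]).
  rewrite -big_distrr /= (_ : \big[_/_]_(x <- _) _ = setT) ?setIT //.
  apply/seteqP; split => // w _.
  by rewrite -bigcup_seq /=; exists (w v) => //=; rewrite mem_index_enum.
rewrite {1}BE ge0_integral_bigsetU //.
- rewrite -sumEFin; apply: eq_bigr => x _.
  transitivity (\int[mu]_(w in B `&` [set w | w v = x])
     ((g v x)%:E * (\prod_(u <- s) g u (w u))%:E))%E.
    apply: eq_integral => w; rewrite inE => -[_ /= wv].
    by rewrite big_cons wv EFinM.
  rewrite ge0_integralZl_EFin //.
  + rewrite (IH _ (upd w0 v x)) // -EFinM -mulr_cfg_sumr; congr EFin.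
    apply: eq_cfg_sum => w hw; rewrite big_cons mulrA agree_cons.
    have -> : w v = x by rewrite hw // updE.
    by congr (_ * fine (mu _)); rewrite -setIA; congr (_ `&` _); rewrite setIC.
  + by move=> w _; rewrite lee_fin prodr_ge0.
  + apply/measurable_EFinP; apply: measurable_funTS.
    exact: measurable_fun_prod_coord.
- exact: index_enum_uniq.
- by move=> x y _ _ [w [[_ <-] [_ <-]]].
- rewrite -BE; apply/measurable_EFinP; apply: measurable_funTS.
  exact: measurable_fun_prod_coord.
- by move=> w _; rewrite lee_fin prodr_ge0.
Qed.

End IntegralDecomposition.

(** * The rooted tree *)

Section RootedTree.
Context (V : choiceType) (e : rel V) (d : nat) (he : cayley_tree e d) (r : V).

Lemma tree_path_exists v : exists p, self_avoiding e r v p.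
Proof. by case: he => _ _ /(_ r v) [p [hp _]] _ _; exists p. Qed.

(* As in [self_avoiding], the starting point [r] is not listed. *)
Definition geo v : seq V := projT1 (cid (tree_path_exists v)).

Lemma geoP v : self_avoiding e r v (geo v).
Proof. exact: projT2 (cid (tree_path_exists v)). Qed.

Lemma geo_unique v p : self_avoiding e r v p -> geo v = p.
Proof.
case: he => _ _ /(_ r v) [q [_ hq]] _ _ hp.
by rewrite -(hq _ hp) (hq _ (geoP v)).
Qed.

Lemma geo_prefix v p1 p2 : geo v = p1 ++ p2 -> geo (last r p1) = p1.
Proof.
move=> E; apply: geo_unique; have [] := geoP v.
rewrite E cat_path -cat_cons cat_uniq => /andP[h1 _] /and3P[h2 _ _] _.
by split.
Qed.

Lemma geo_rcons u v : e u v -> v \notin r :: geo u -> geo v = rcons (geo u) v.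
Proof.
move=> euv vu; have [hp hu hl] := geoP u; apply: geo_unique; split.
- by rewrite rcons_path hp hl.
- by rewrite -rcons_cons rcons_uniq vu hu.
- by rewrite last_rcons.
Qed.

(** If [v] is off the path to [u], the edge extends that path. Otherwise [v] cuts it at a prefix,
    which is the path to [v]; this prefix avoids [u], so the edge extends it to the path to [u]. *)
Lemma geo_adj u v : e u v -> geo v = rcons (geo u) v \/ geo u = rcons (geo v) u.
Proof.
move=> euv; have [vu|vu] := boolP (v \in r :: geo u); last first.
  by left; exact: geo_rcons.
right; apply: geo_rcons; first by case: he => /(_ u v) <-.
move: vu (geoP u) (@geo_prefix u); move: (geo u) => p.
case/splitPl => p1 p2 lp1 [_ un lu] /(_ _ _ erefl); rewrite lp1 => ->.
move: un; rewrite -cat_cons cat_uniq => /and3P[_ /hasPn h _]; apply: h.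
move: lu; rewrite last_cat lp1; case: p2 => [/= vu|w p2 /= <-].
  by case: he => _ /(_ u) + _ _ _; rewrite -{2}vu euv.
exact: mem_last.
Qed.

Definition depth v := size (geo v).

(** The last vertex but one on the path from the root; at the root itself the value is [r]. *)
Definition par v := last r (take (depth v).-1 (geo v)).

Definition nb v : seq V := enum_fset (fset_set [set u | e v u]).

Definition ch v := [seq c <- nb v | geo c == rcons (geo v) c].

Lemma finite_nb v : finite_set [set u | e v u].
Proof. by case: he => _ _ _ _ /(_ v) h; exists d.+1. Qed.

Lemma mem_nb v u : (u \in nb v) = e v u.
Proof.
have := in_fset_set (finite_nb v) u; rewrite /nb => ->.
by apply/idP/idP; rewrite inE.
Qed.

Lemma uniq_nb v : uniq (nb v).
Proof. exact: fset_uniq. Qed.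

Lemma size_nb v : size (nb v) = d.+1.
Proof.
case: he => _ _ _ _ /(_ v) h; apply/card_eq_fsetP.
by rewrite fset_setK //; exact: finite_nb.
Qed.

Lemma mem_ch v c : (c \in ch v) = e v c && (geo c == rcons (geo v) c).
Proof. by rewrite mem_filter mem_nb andbC. Qed.

Lemma uniq_ch v : uniq (ch v).
Proof. exact/filter_uniq/uniq_nb. Qed.

Lemma depth_root : depth r = 0%N.
Proof. by rewrite /depth (@geo_unique r [::]). Qed.

Lemma depth_gt0 v : v != r -> (0 < depth v)%N.
Proof.
rewrite /depth lt0n size_eq0; apply: contraNneq => E.
by have [_ _] := geoP v; rewrite E => <-.
Qed.

Lemma depth_ch v c : c \in ch v -> depth c = (depth v).+1.
Proof. by rewrite mem_ch /depth => /andP[_ /eqP ->]; rewrite size_rcons. Qed.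

Lemma par_ch v c : c \in ch v -> par c = v.
Proof.
rewrite mem_ch /par /depth => /andP[_ /eqP ->]; rewrite size_rcons /=.
by rewrite -cats1 take_size_cat //; have [] := geoP v.
Qed.

Lemma ch_par v : v != r -> v \in ch (par v).
Proof.
move=> /depth_gt0; case/lastP E : (geo v) => [|p w]; first by rewrite /depth E.
move=> _; have [+ _] := geoP v; rewrite E last_rcons rcons_path.
move=> /andP[_ ew] wv; move: E ew; rewrite {}wv => E ew.
have parE : par v = last r p.
  by rewrite /par /depth E size_rcons -cats1 take_size_cat.
rewrite mem_ch parE ew (@geo_prefix v _ [:: v]) ?E ?eqxx //.
by rewrite cats1.
Qed.

Lemma adj_par u v : e u v ->
  (v != r /\ u = par v) \/ (u != r /\ v = par u).
Proof.
move=> euv; have neq w p : geo w = rcons p w -> w != r.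
  move=> h; apply/eqP => wr; move: (congr1 size h).
  by rewrite wr (@geo_unique r [::]) // size_rcons.
case: (geo_adj euv) => h; [left|right]; split; try exact: neq h.
  by rewrite (@par_ch u) // mem_ch euv h eqxx.
rewrite (@par_ch v) // mem_ch h eqxx andbT.
by case: he => /(_ u v) <-.
Qed.

(** Of the [d.+1] neighbours, only the parent can fail to be a child. *)
Lemma size_ch v : v != r -> (d <= size (ch v))%N.
Proof.
move=> vr; rewrite size_filter -ltnS -(size_nb v).
rewrite -(count_predC (fun c => geo c == rcons (geo v) c) (nb v)) addnC -add1n.
rewrite leq_add2r -size_filter.
rewrite -[1%N]/(size [:: par v]); apply: uniq_leq_size.
  exact/filter_uniq/uniq_nb.
move=> u; rewrite mem_filter mem_nb => /andP[/= hu evu].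
have [[ur E]|[_ ->]] := adj_par evu; last exact: mem_head.
by move: hu; have := ch_par ur; rewrite -E mem_ch => /andP[_ ->].
Qed.

Lemma ch_root : ch r = nb r.
Proof.
apply/all_filterP/allP => c; rewrite mem_nb => erc.
have [[cr E]|[]] := adj_par erc; last by rewrite eqxx.
by have := ch_par cr; rewrite -E mem_ch => /andP[_].
Qed.

Fixpoint lev k : seq V :=
  if k is k'.+1 then flatten [seq ch v | v <- lev k'] else [:: r].

(** The ball without its centre: exactly these vertices own an edge to a parent, and the spin at the
    root is handled separately. *)
Fixpoint rest k : seq V := if k is k'.+1 then rest k' ++ lev k'.+1 else [::].

Lemma mem_lev k v : (v \in lev k) = (depth v == k).
Proof.
elim: k v => [|k IH] v /=.
  rewrite inE; apply/eqP/eqP => [->|h]; first exact: depth_root.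
  by apply/eqP; apply: contraTT (leqnn (depth v)) => /depth_gt0; rewrite h.
apply/flatten_mapP/eqP => [[u]|dv].
  by rewrite IH => /eqP <- /depth_ch.
have vr : v != r by apply/eqP => vr; move: dv; rewrite vr depth_root.
exists (par v); last exact: ch_par.
by rewrite IH -eqSS -(depth_ch (ch_par vr)) dv.
Qed.

Lemma uniq_lev k : uniq (lev k).
Proof.
elim: k => //= k; elim: (lev k) => //= v s IH /andP[vs us].
rewrite cat_uniq uniq_ch IH // andbT; apply/hasPn => c /flatten_mapP[u us' cu].
by apply/negP => /par_ch; rewrite (par_ch cu) => uv; move: vs; rewrite -uv us'.
Qed.

Lemma mem_rest k v : (v \in rest k) = (0 < depth v <= k)%N.
Proof.
elim: k v => [|k IH] v /=; first by case: depth.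
rewrite mem_cat IH -[flatten _]/(lev k.+1) mem_lev; lia.
Qed.

Lemma root_notin_rest k : r \notin rest k.
Proof. by rewrite mem_rest depth_root. Qed.

Lemma uniq_rest k : uniq (rest k).
Proof.
elim: k => [//|k IH]; rewrite /= cat_uniq IH -[flatten _]/(lev k.+1) uniq_lev andbT.
by apply/hasPn => v; rewrite mem_lev mem_rest => /eqP ->; rewrite ltnn andbF.
Qed.

Lemma mem_ball k v : (v \in r :: rest k) = (depth v <= k)%N.
Proof.
rewrite inE mem_rest; have [->|/depth_gt0 ->//] := eqVneq v r.
by rewrite depth_root.
Qed.

Lemma exists_ball (L : {fset V}) : exists k, forall v, v \in L -> (depth v <= k)%N.
Proof.
exists (\max_(v <- enum_fset L) depth v)%N => v vL.
by rewrite (big_rem v) //= leq_maxl.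
Qed.

End RootedTree.

(** * Messages towards the root *)

Definition repel (x y : spin) : bool := spin_val x * spin_val y == -1.

(** Each factor contributes one [m], and those beyond the first [k] only lower the product because
    [m <= 1]. *)
Lemma prodr_le_expr (R : numDomainType) (I : eqType) (s : seq I) (f g : I -> R) m k :
  0 <= m <= 1 -> (k <= size s)%N ->
  (forall i, i \in s -> 0 <= f i <= m * g i) -> (forall i, 0 <= g i) ->
  \prod_(i <- s) f i <= m ^+ k * \prod_(i <- s) g i.
Proof.
move=> m01 ks fg g0; apply: (@le_trans _ _ (\prod_(i <- s) (m * g i))).
  by rewrite big_seq [leRHS]big_seq; apply: ler_prod => i /fg.
rewrite big_split /= big_const_seq count_predT iter_mulr_1 ler_wpM2r ?prodr_ge0 //.
by rewrite -(subnKC ks) exprD ler_piMr ?exprn_ge0 ?exprn_ile1//; case/andP: m01.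
Qed.

Section Messages.
Context (R : realType) (V : choiceType) (e : rel V) (d : nat).
Context (he : cayley_tree e d) (r : V) (q : R) (a : V -> spin -> R).

Local Notation ch := (ch he r).
Local Notation par := (par he r).
Local Notation depth := (depth he r).
Local Notation lev := (lev he r).
Local Notation rest := (rest he r).

Definition bond x y : R := if repel x y then q else 1.

(* [msg n v y] is the partition function of the first [n] levels of the subtree
   rooted at [v], given the spin [y] at the parent of [v]. *)
Fixpoint msg n v y : R :=
  if n is m.+1 then \sum_x bond y x * (a v x * \prod_(c <- ch v) msg m c x)
  else 1.

Definition tree_weight k (w : V -> spin) : R :=
  \prod_(v <- rest k) (bond (w (par v)) (w v) * a v (w v)).

Lemma depth_par v : v != r -> depth v = (depth (par v)).+1.
Proof. by move=> vr; rewrite -(depth_ch (ch_par he vr)). Qed.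

Lemma prod_lev k (F : V -> R) :
  \prod_(v <- lev k.+1) F v = \prod_(v <- lev k) \prod_(c <- ch v) F c.
Proof. by rewrite /= big_flatten big_map. Qed.

(** Given the spins up to level [k], those on level [k.+1] are independent. Summing them out absorbs
    the messages of their children and yields messages one level deeper. *)
Lemma cfg_sum_level k j w :
  cfg_sum (rest k.+1) (fun w => tree_weight k.+1 w *
     \prod_(v <- lev k.+2) msg j v (w (par v))) w =
  cfg_sum (rest k) (fun w => tree_weight k w *
     \prod_(v <- lev k.+1) msg j.+1 v (w (par v))) w.
Proof.
(* The factor of a vertex reads the spin of its parent, which is not on the level being summed. *)
have lev_par u v : u \in lev k.+1 -> v \in lev k.+1 -> par u != v.
  rewrite !mem_lev => /eqP du /eqP dv; apply/eqP => uv.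
  have ur : u != r by apply/eqP => ur; move: du; rewrite ur depth_root.
  by move: (depth_par ur); rewrite uv; lia.
rewrite [rest k.+1]/= cfg_sum_cat -[flatten _]/(lev k.+1).
apply: eq_cfg_sum => w' _.
pose g v w x := bond (w (par v)) x * (a v x * \prod_(c <- ch v) msg j c x).
rewrite -[RHS](@cfg_sum_prod _ _ (lev k.+1) (tree_weight k) g) ?uniq_lev //.
- apply: eq_cfg_sum => w2 _.
  rewrite prod_lev [tree_weight k.+1 w2]big_cat -mulrA; congr (_ * _).
  rewrite -big_split /=; apply: eq_bigr => v _.
  rewrite /g -mulrA; congr (_ * (_ * _)).
  by apply: eq_big_seq => c /par_ch ->.
- move=> w2 v x; rewrite mem_lev => /eqP dv; rewrite /tree_weight.
  apply: eq_big_seq => u; rewrite mem_rest => du.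
  have ur : u != r by apply/eqP => ur; move: du; rewrite ur depth_root.
  have := depth_par ur => du2.
  by rewrite !upd_neq //; apply: contraTneq du => E; move: du2; rewrite E; lia.
- by move=> u w2 v x us vs; rewrite /g upd_neq // lev_par.
Qed.

(** Starting from the trivial messages [msg 0] outside the ball, the levels are summed out
    inwards. *)
Lemma cfg_sum_tree_weight k w :
  cfg_sum (rest k) (tree_weight k) w = \prod_(c <- ch r) msg k c (w r).
Proof.
transitivity (cfg_sum (rest k) (fun w => tree_weight k w *
     \prod_(v <- lev k.+1) msg 0 v (w (par v))) w).
  by apply: eq_cfg_sum => w' _; rewrite big1_eq mulr1.
(* The message depth is generalised to [j], as it grows by one whenever the radius shrinks by
   one. *)
rewrite -[in RHS](addn0 k); elim: k 0%N => [|k IH] j.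
  rewrite /= cats0 /tree_weight big_nil mul1r.
  by apply: eq_big_seq => c /par_ch ->.
by rewrite cfg_sum_level IH addSnnS.
Qed.

Lemma bondE : (bond spin_neg spin_neg = 1) * (bond spin_neg spin_pos = q) *
  (bond spin_pos spin_neg = q) * (bond spin_pos spin_pos = 1) *
  (forall x, bond spin_zero x = 1) * (forall x, bond x spin_zero = 1).
Proof. by rewrite /bond /repel; do ![split]; case. Qed.

(** * The cavity recursion and bounds on messages *)

Hypotheses (q0 : 0 < q) (q9 : q <= 9^-1) (hd : (2 <= d)%N).
Hypotheses (a0 : forall v, a v spin_zero = 0) (an : forall v, 0 < a v spin_neg)
  (ap : forall v, 0 < a v spin_pos).

(** The weight of the subtree at [v] with the spin there fixed and the edge to the parent cut, as in
    the cavity method. *)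
Definition cavity n v x : R := a v x * \prod_(c <- ch v) msg n c x.

Lemma msgS n v : (msg n.+1 v spin_neg = cavity n v spin_neg + q * cavity n v spin_pos) *
  (msg n.+1 v spin_zero = cavity n v spin_neg + cavity n v spin_pos) *
  (msg n.+1 v spin_pos = q * cavity n v spin_neg + cavity n v spin_pos).
Proof.
have c0 : a v spin_zero * \prod_(c <- ch v) msg n c spin_zero = 0 by rewrite a0 mul0r.
by rewrite /= !sum_spin !bondE c0 !mul1r !addr0.
Qed.

Lemma msg_gt0 n v y : 0 < msg n v y.
Proof.
elim: n v y => [//|n IH] v y.
have P x : 0 < \prod_(c <- ch v) msg n c x by apply: prodr_gt0.
have := mulr_gt0 (an v) (P spin_neg); have := mulr_gt0 (ap v) (P spin_pos).
rewrite -/(cavity n v spin_pos) -/(cavity n v spin_neg) => hp hn.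
by case: y; rewrite msgS ?addr_gt0 ?mulr_gt0.
Qed.

Lemma cavity_gt0 n v : (0 < cavity n v spin_neg) * (0 < cavity n v spin_pos).
Proof. by split; rewrite mulr_gt0 ?prodr_gt0 // => c _; exact: msg_gt0. Qed.

(** Turning the parent spin from zero to minus changes a single bond, at the price of a factor at
    least [q]. *)
Lemma msg_zero_le n v : q * msg n v spin_zero <= msg n v spin_neg.
Proof.
case: n => [|n]; first by rewrite /=; move: q0 q9; lra.
rewrite !msgS mulrDr lerD2r ger_pMl ?cavity_gt0 //; move: q0 q9; lra.
Qed.

(** Ferromagnetic monotonicity: as [q <= 1], a bond passes a preference for plus on to the
    parent. *)
Lemma msg_neg_le_pos n v : (forall v, a v spin_neg <= a v spin_pos) ->
  msg n v spin_neg <= msg n v spin_pos.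
Proof.
move=> np; elim: n v => [//|n IH] v.
have h : cavity n v spin_neg <= cavity n v spin_pos.
  apply: ler_pM => //; first exact: ltW.
    by apply: prodr_ge0 => c _; rewrite ltW ?msg_gt0.
  by apply: ler_prod => c _; rewrite IH ltW ?msg_gt0.
rewrite !msgS; have := cavity_gt0 n v; (move: q0 q9; nra).
Qed.

(* If the cavity odds plus:minus at a vertex are [x], then those of its message
   to the parent are [odds_map x]. *)
Definition odds_map (x : R) : R := (x + q) / (1 + q * x).

Lemma odds_map_itv x : 0 <= x <= 1 -> 0 <= odds_map x <= 1.
Proof.
move=> /andP[x0 x1]; have p : 0 < 1 + q * x.
  by rewrite ltr_wpDr // mulr_ge0 // ltW.
apply/andP; split; first by rewrite divr_ge0 ?(ltW p) // addr_ge0 // ltW.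
by rewrite /odds_map ler_pdivrMr // mul1r; (move: q0 q9; nra).
Qed.

(** Two children square the odds, so this says that a tree level alone cannot increase them; at
    [x = 1] there is equality, and only the field pushes the odds down. In the second factor below,
    [x (1 - 2 q) >= 7/81] while the terms with [q ^+ 2] are at most 3/81. *)
Lemma odds_map_sqr x : 9^-1 <= x <= 1 -> odds_map x ^+ 2 <= x.
Proof.
move=> /andP[x0 x1]; have x00 : 0 < x by apply: lt_le_trans x0.
rewrite /odds_map expr_div_n ler_pdivrMr ?exprn_gt0 ?addr_gt0 ?mulr_gt0 //.
rewrite -subr_ge0.
have -> : x * (1 + q * x) ^+ 2 - (x + q) ^+ 2 =
  (1 - x) * (x - 2 * q * x - q ^+ 2 * (1 + x + x ^+ 2)) by ring.
apply: mulr_ge0; first lra.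
have h1 : q ^+ 2 * (1 + x + x ^+ 2) <= (q * 9^-1) * 3.
  apply: ler_pM; first exact: sqr_ge0.
  - by rewrite addr_ge0 ?sqr_ge0 // addr_ge0 // ltW.
  - by rewrite expr2 ler_pM2l.
  - by rewrite expr2; nra.
(move: q0 q9; nra).
Qed.

Lemma odds_map_ninth : 2 * odds_map 9^-1 ^+ 2 <= 9^-1.
Proof.
(* The numerator is at most 2/9 and the denominator at least 1; then 2 (2/9)^2 = 8/81 is below
   9/81. *)
have h : odds_map 9^-1 <= 2 / 9.
  by rewrite /odds_map ler_pdivrMr; [move: q0 q9; lra|rewrite addr_gt0 ?mulr_gt0].
have /andP[h0 _] : 0 <= odds_map 9^-1 <= 1 by apply: odds_map_itv; move: q0 q9; lra.
rewrite expr2; (move: q0 q9; nra).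
Qed.

(** After clearing the denominator, the difference of the two sides is [1 - q ^+ 2] times that of
    the hypothesis. *)
Lemma msg_odds n v x : 0 <= x -> cavity n v spin_pos <= x * cavity n v spin_neg ->
  msg n.+1 v spin_pos <= odds_map x * msg n.+1 v spin_neg.
Proof.
move=> x0 h; rewrite /odds_map mulrAC ler_pdivlMr; last first.
  by rewrite ltr_wpDr // mulr_ge0 // ltW.
rewrite !msgS -subr_ge0.
move: h; rewrite -subr_ge0.
set A := cavity _ _ spin_pos; set B := cavity _ _ spin_neg => h.
rewrite (_ : _ - _ = (1 - q ^+ 2) * (x * B - A)); last by ring.
apply: mulr_ge0 => //; rewrite subr_ge0 exprn_ile1 ?(ltW q0) //; move: q0 q9; lra.
Qed.

(** A vertex other than the root has at least [d >= 2] children, each contributing a factor [m <= 1]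
    to the odds. *)
Lemma cavity_odds n v m f : v != r -> 0 <= m <= 1 ->
  (forall c, c \in ch v -> msg n c spin_pos <= m * msg n c spin_neg) ->
  a v spin_pos <= f * a v spin_neg ->
  cavity n v spin_pos <= (f * m ^+ 2) * cavity n v spin_neg.
Proof.
move=> vr m01 hc hf; rewrite /cavity mulrACA.
apply: ler_pM => //; first exact: ltW.
  by apply: prodr_ge0 => c _; rewrite ltW ?msg_gt0.
apply: prodr_le_expr => //.
- exact: leq_trans (size_ch he vr).
- by move=> c /hc ->; rewrite ltW ?msg_gt0.
- by move=> c; rewrite ltW ?msg_gt0.
Qed.

(** * Decay of the odds across the annulus and stability inside it *)

Variables (n0 : nat) (b : R).
Hypothesis b1 : 1 < b.
Hypothesis a_out : forall v, (n0 < depth v)%N -> a v spin_pos <= b^-1 * a v spin_neg.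
Hypothesis a_in : forall v, a v spin_pos <= 2 * a v spin_neg.

(** The free boundary starts at odds 1, a fixed point of [odds_map]. Each level gains a factor
    [b^-1] from the field and loses nothing by [odds_map_sqr]; the maximum appears because that
    bound is available only from 1/9 on. *)
Lemma msg_annulus j v : (n0 < depth v)%N ->
  msg j v spin_pos <= odds_map (Num.max 9^-1 (b^-1 ^+ j)) * msg j v spin_neg.
Proof.
elim: j v => [|j IH] v dv.
  rewrite expr0 (max_idPr _); last lra.
  by rewrite /= mulr1 /odds_map mulr1 divff // gt_eqF // addr_gt0.
have b0 : 0 < b^-1 by rewrite invr_gt0 (lt_trans _ b1).
have b11 : b^-1 <= 1 by rewrite invf_le1 ?ltW // (lt_trans _ b1).
have bj : 0 <= b^-1 ^+ j <= 1 by rewrite exprn_ge0 ?exprn_ile1 // ltW.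
have vr : v != r by apply/eqP => vr; move: dv; rewrite vr depth_root.
set m := Num.max 9^-1 (b^-1 ^+ j); set m' := Num.max _ _.
have m1 : 9^-1 <= m <= 1.
  by rewrite le_max lexx /= ge_max; case/andP: bj => _ ->; rewrite andbT; lra.
have m01 : 0 <= m <= 1 by case/andP: m1 => h ->; rewrite andbT; lra.
have m'0 : 9^-1 <= m' by rewrite le_max lexx.
have mm' : b^-1 * odds_map m ^+ 2 <= m'.
  apply: (@le_trans _ _ (b^-1 * m)); first by rewrite ler_pM2l ?odds_map_sqr.
  rewrite /m /m' maxr_pMr ?(ltW b0) // ge_max -exprS !le_max lexx orbT andbT.
  by rewrite ger_pMl ?b11 //; lra.
apply: msg_odds; first by apply: le_trans m'0; rewrite invr_ge0.
apply: le_trans (cavity_odds vr (odds_map_itv m01) _ (a_out dv)) _.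
  by move=> c /depth_ch dc; apply: IH; rewrite dc ltnS ltnW.
by rewrite ler_pM2r ?cavity_gt0.
Qed.

(** The depth condition says that the message covers the levels [n0 + 1] to [n0 + K], which bring
    the odds to 1/9. Further inwards [odds_map_ninth] keeps them there, even against a field with
    odds 2. *)
Lemma msg_interior K n v : b^-1 ^+ K <= 9^-1 -> v != r ->
  (depth v <= n0.+1)%N -> (n0.+1 + K <= n + depth v)%N ->
  msg n v spin_pos <= odds_map 9^-1 * msg n v spin_neg.
Proof.
move=> bK; elim: n v => [|n IH] v vr dv nK.
  (* An empty message leaves room only for [K = 0], where the hypothesis would read [1 <= 9^-1]. *)
  have {}dv : depth v = n0.+1 by lia.
  have K0 : K = 0%N by lia.
  by move: bK; rewrite K0 expr0; lra.
have b0 : 0 < b^-1 by rewrite invr_gt0 (lt_trans _ b1).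
have b11 : b^-1 <= 1 by rewrite invf_le1 ?ltW // (lt_trans _ b1).
have [dn0|dn0] := ltnP n0 (depth v).
  have := @msg_annulus n.+1 v dn0; rewrite (max_idPl _) //.
  apply: le_trans bK; rewrite -(subnKC (_ : K <= n.+1)%N); last by lia.
  by rewrite exprD ler_piMr ?exprn_ge0 ?exprn_ile1 // ltW.
apply: msg_odds; first lra.
have i9 : 0 <= (9^-1 : R) <= 1 by apply/andP; split; lra.
apply: le_trans (cavity_odds vr (odds_map_itv i9) _ (a_in v)) _.
  move=> c cv; apply: IH; rewrite ?(depth_ch cv) //; last by lia.
  by apply/eqP => cr; move: (depth_ch cv); rewrite cr depth_root.
by rewrite ler_pM2r ?cavity_gt0 // odds_map_ninth.
Qed.

End Messages.

Arguments lev : simpl never.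
Arguments rest : simpl never.

(** * Gibbs weight of a ball with zero boundary *)

Section GibbsWeight.
Context (R : realType) (V : choiceType) (e : rel V) (d : nat).
Context (he : cayley_tree e d) (r : V) (beta lambda : R).

Local Notation par := (par he r).
Local Notation depth := (depth he r).
Local Notation lev := (lev he r).
Local Notation rest := (rest he r).
Local Notation ball := (fun k => r :: rest k).

Definition parent_edge v : {fset V} := [fset par v; v]%fset.

Lemma repel_edge (w : V -> spin) u v :
  [exists i : [fset u; v]%fset, exists j : [fset u; v]%fset,
     spin_val (w (val i)) * spin_val (w (val j)) == -1] = repel (w u) (w v).
Proof.
apply/existsP/idP => [[[i /= hi]] /existsP[[j /= hj]] |h].
  move: hi hj; rewrite !inE /repel => /orP[]/eqP-> /orP[]/eqP->;
    rewrite 1?mulrC //; by case: (w _).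
have hu : u \in [fset u; v]%fset by rewrite !inE eqxx.
have hv : v \in [fset u; v]%fset by rewrite !inE eqxx orbT.
by exists [` hu]%fset; apply/existsP; exists [` hv]%fset.
Qed.

Lemma par_edge v : v != r -> e (par v) v.
Proof. by move=> /(ch_par he); rewrite mem_ch => /andP[]. Qed.

Lemma rest_neq_root k v : v \in rest k -> v != r.
Proof. by apply: contraTneq => ->; exact: root_notin_rest. Qed.

Lemma parent_edge_inj k : {in rest k &, injective parent_edge}.
Proof.
move=> u v /rest_neq_root ur /rest_neq_root vr E.
have : u \in parent_edge v by rewrite -E !inE eqxx orbT.
have : v \in parent_edge u by rewrite E !inE eqxx orbT.
rewrite !inE => /orP[/eqP vu|/eqP->//] /orP[/eqP uv|/eqP//].
by have := depth_par he ur; have := depth_par he vr; rewrite -uv -vu; lia.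
Qed.

(** Every edge joins a vertex to its parent, and it meets the ball exactly when the parent is
    inside, that is, when the child has depth at most [N.+1]. *)
Lemma edges_ball N : [set E | edges e E /\ exists2 i, i \in E & i \in fset_of (ball N)]
  = [set` [seq parent_edge v | v <- rest N.+1]].
Proof.
have esym u v : e u v = e v u by case: he => /(_ u v).
apply/seteqP; split => E /=.
  case=> -[u [v [euv ->{E}]]] [i iE]; rewrite mem_fset_of mem_ball => di.
  wlog [vr uv] : u v euv iE / v != r /\ u = par v.
    move=> H; case: (adj_par he r euv); first by move=> ?; exact: (H u v).
    by rewrite fsetUC in iE *; move=> ?; apply: (H v u) => //; rewrite esym.
  apply/mapP; exists v; last by rewrite uv.
  rewrite mem_rest (depth_gt0 he vr) /= (depth_par he vr) ltnS -uv.
  move: iE; rewrite !inE => /orP[]/eqP ii; rewrite -?ii // .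
  by apply: leq_trans di; rewrite ii (depth_par he vr) uv.
case/mapP => v vR ->; have vr := rest_neq_root vR; split.
  by exists (par v), v; split => //; exact: par_edge.
exists (par v); first by rewrite !inE eqxx.
rewrite mem_fset_of mem_ball; move: vR; rewrite mem_rest (depth_par he vr); lia.
Qed.

Lemma repel0 x : (repel x spin_zero = false) * (repel spin_zero x = false).
Proof. by case: x. Qed.

(** The zeros on the sphere silence both the edges that reach it from inside and those that leave
    it. Thus the weight of the ball is shielded from the outside. *)
Lemma repulsions_ball N (w : V -> spin) :
  (forall v, v \in lev N.+1 -> w v = spin_zero) ->
  repulsions R e (fset_of (ball N.+1)) w =
  \sum_(v <- rest N) (repel (w (par v)) (w v))%:R.
Proof.
move=> w0; rewrite /repulsions edges_ball -fsbig_seq; last first.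
  by rewrite map_inj_in_uniq ?uniq_rest //; exact: parent_edge_inj.
rewrite big_map; under eq_bigr do rewrite repel_edge.
rewrite -[rest N.+2]/((rest N ++ lev N.+1) ++ lev N.+2) !big_cat /=.
rewrite [X in _ + X + _]big1_seq ?addr0.
  rewrite [X in _ + X]big1_seq ?addr0 // => v /andP[_ vl].
  rewrite w0 ?repel0 //; move: vl; rewrite !mem_lev => /eqP dv.
  have vr : v != r by apply: contra_eq_neq dv => ->; rewrite depth_root.
  by rewrite -eqSS -(depth_par he vr) dv.
by move=> v /andP[_ vl]; rewrite (w0 v) ?repel0.
Qed.

Lemma weight_gt0 (L : {fset V}) (tau : {ffun L -> spin}) eta : 0 < lambda ->
  0 < weight e beta lambda tau eta.
Proof.
move=> l0; rewrite mulr_gt0 ?expR_gt0 // prodr_gt0 // => i _.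
exact: exprz_gt0.
Qed.

Lemma partition_function_gt0 (L : {fset V}) eta : 0 < lambda ->
  0 < partition_function e beta lambda L eta.
Proof.
move=> l0; rewrite /partition_function (bigD1 [ffun=> spin_zero]) //=.
rewrite ltr_pwDl ?weight_gt0 // sumr_ge0 // => tau _.
by rewrite ltW ?weight_gt0.
Qed.

Definition ball_weight N (w : V -> spin) : R :=
  \prod_(v <- ball N) lambda ^ (spin_val (w v) ^+ 2) *
  \prod_(v <- rest N) bond (expR (- beta)) (w (par v)) (w v).

Lemma weight_ball N (w eta : V -> spin) :
  (forall v, v \in lev N.+1 -> w v = spin_zero) ->
  weight e beta lambda (restrict (ball N.+1) w) eta = ball_weight N w.
Proof.
move=> w0; set s := ball N.+1; pose g := glue_config (restrict s w) eta.
have gE v : v \in s -> g v = w v.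
  move=> vs; rewrite /g /glue_config insubT ?mem_fset_of // => h.
  by rewrite /= ffunE.
have ls v : v \in lev N.+1 -> v \in s.
  by rewrite mem_ball mem_lev => /eqP ->.
have rs v : v \in rest N -> (v \in s) * (par v \in s).
  move=> vR; have vr := rest_neq_root vR.
  move: vR; rewrite !mem_ball mem_rest (depth_par he vr); split; lia.
rewrite /weight -/g repulsions_ball; last by move=> v vl; rewrite gE ?w0 ?ls.
rewrite mulrC; congr (_ * _).
  transitivity (\prod_(i : fset_of s) lambda ^ (spin_val (w (val i)) ^+ 2)).
    by apply: eq_bigr => i _; rewrite ffunE.
  rewrite (@prod_fset_of _ _ s (fun v => lambda ^ (spin_val (w v) ^+ 2))); last first.
    by rewrite /s /= root_notin_rest uniq_rest.
  rewrite /s -[rest N.+1]/(rest N ++ lev N.+1) -cat_cons big_cat /=.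
  by rewrite [X in _ * X]big1_seq ?mulr1 // => v /andP[_ /w0 ->].
rewrite mulr_sumr expR_sum; apply: eq_big_seq => v /rs[vs ps].
by rewrite !gE // /bond; case: repel; rewrite ?mulr1 ?mulr0 ?expR0.
Qed.

Lemma ball_weight_zero N : ball_weight N (fun=> spin_zero) = 1.
Proof. by rewrite /ball_weight !big1 ?mulr1 // => v _; rewrite bondE. Qed.

(** [C] is the probability of the zero configuration on the ball, whose weight is 1. For every
    boundary condition the kernel gives the other pinned configurations [ball_weight] times as much,
    and integration preserves this ratio. *)
Lemma gibbs_ball (mu : probability (Config V) R) N : 0 < lambda ->
  wr_gibbs_measure e beta lambda mu ->
  exists2 C : R, 0 < C & forall w, (forall v, v \in lev N.+1 -> w v = spin_zero) ->
    mu (agree (ball N.+1) w) = (C * ball_weight N w)%:E.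
Proof.
move=> l0 [gamma [[gp gc] gw] mc]; set s := ball N.+1; pose L := fset_of s.
pose o : V -> spin := fun=> spin_zero.
have mA w : measurable (agree s w : set (Config V)) by exact: measurable_agree.
have gE w eta : (forall v, v \in lev N.+1 -> w v = spin_zero) ->
    gamma L eta (agree s w) =
    ((partition_function e beta lambda L eta)^-1 * ball_weight N w)%:E.
  by move=> w0; rewrite -cylinder_restrict gw weight_ball.
have mg w : measurable_fun [set: Config V] (fun eta => gamma L eta (agree s w)).
  apply: measurable_fun_Omega_subset; exact: (measurable_kernel (gamma L)).
have mE w : (forall v, v \in lev N.+1 -> w v = spin_zero) ->
    (mu (agree s w) = (ball_weight N w)%:E * mu (agree s o))%E.
  move=> w0; rewrite (mc L _ (mA w)) (mc L _ (mA o)) -ge0_integralZl_EFin //.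
  - apply: eq_integral => eta _.
    by rewrite !gE // ball_weight_zero mulr1 -EFinM mulrC.
  - rewrite /ball_weight mulr_ge0 ?prodr_ge0 // => v _; first exact/ltW/exprz_gt0.
    by rewrite /bond; case: ifP => // _; exact: expR_ge0.
exists (fine (mu (agree s o))); last first.
  move=> w w0; rewrite mE // -[X in (_ * X)%E]fineK ?fin_num_measure //.
  by rewrite -EFinM mulrC.
rewrite fine_gt0 // ltey_eq fin_num_measure // andbT lt0e measure_ge0 andbT.
(* The kernel charges the zero configuration under every boundary condition, so a vanishing integral
   would make the whole space a null set. *)
apply/eqP => m0.
have := mc L _ (mA o); rewrite m0 => /esym.
under eq_integral do rewrite -[gamma _ _ _]gee0_abs //.
move=> /(ae_eq_integral_abs mu measurableT (mg o)) [N0 [mN0 mu0 hN]].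
have NT : N0 = setT.
  apply/seteqP; split => // eta _; apply: hN => /= /(_ Logic.I).
  rewrite gE // => /eqP; rewrite eqe ball_weight_zero mulr1 invr_eq0.
  by rewrite gt_eqF // partition_function_gt0.
have := probability_setT mu; rewrite -NT [mu _]mu0 => /esym/eqP.
by rewrite eqe oner_eq0.
Qed.

End GibbsWeight.

(** * Non-Gibbsianness *)

Section QuasilocalApproximation.
Context (R : realType) (V : choiceType).
Variables (nu : probability (Config V) R) (gamma : kernel_family R V).
Hypotheses (gp : proper_kernels gamma) (gq : quasilocal_spec gamma).
Hypothesis (gc : compatible nu gamma).

(** By properness the kernel gives [C] no mass if [eta] lies outside it, and its complement no mass
    if [eta] lies inside. *)
Lemma proper_kernel_setI (L : {fset V}) eta (A C : set (Config V)) :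
  measurable A -> measurable (C : set (Omega (~` [set` L]))) ->
  gamma L eta (A `&` C) = ((fun eta => gamma L eta A) \_ C) eta.
Proof.
move=> mA mC; have mC' : measurable (C : set (Config V)).
  exact: measurable_Omega_subset mC.
have g1 (B : set (Omega (~` [set` L]))) : measurable B ->
    ~ B eta -> gamma L eta (A `&` B) = 0%E.
  move=> mB nB; have mB' := measurable_Omega_subset mB.
  apply/eqP; rewrite eq_le measure_ge0 andbT.
  apply: (@le_trans _ _ (gamma L eta (B : set (Config V)))).
    by apply: le_measure; rewrite ?inE //; apply: measurableI.
  by rewrite gp // indicE memNset.
rewrite patchE; case: ifPn => [/set_mem Ce|/negP Ce]; last first.
  by apply: g1 => //; move=> Ce'; apply: Ce; rewrite inE.
rewrite [RHS](measureDI _ _ mC') // -[LHS]add0e; congr (_ + _)%E.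
rewrite setDE; apply/esym; apply: (g1 (~` C)); last by move=> /(_ Ce).
exact: (@measurableC _ (Omega (~` [set` L]))).
Qed.

(** [p] is the kernel probability at [eta0]. The kernel is within [eps / 2] of a function local on
    [L], so it varies by at most [eps] over [C]; integrating over [C] gives both bounds. *)
Lemma quasilocal_approx (r : V) y (eta0 : V -> spin) (eps : R) : 0 < eps ->
  exists p (L : {fset V}), forall C : set (Config V),
    measurable (C : set (Omega (~` [set r]))) ->
    (forall w, C w -> forall v, v \in L -> v != r -> w v = eta0 v) ->
    (p - eps) * fine (nu C) <= fine (nu ([set w | w r = y] `&` C))
      <= (p + eps) * fine (nu C).
Proof.
move=> e0; set A : set (Config V) := [set w | w r = y]; pose L0 := [fset r]%fset.
have mA : measurable A by exact: measurable_coord.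
have setL0 : [set` L0] = [set r] by apply/seteqP; split => v; rewrite /= inE => /eqP.
pose h eta := fine (gamma L0 eta A).
have hq : quasilocal h.
  have -> : h = fun eta => Rintegral (gamma L0 eta) setT (\1_A : _ -> R).
    by apply/funext => eta; rewrite /Rintegral /h integral_indic // setIT.
  apply: gq => eps' e0'; exists (\1_A) => [|w]; last by rewrite subrr normr0.
  exists L0; apply: measurable_indic; apply: measurable_coord.
  by rewrite setL0.
have hr w w' : (forall v, v != r -> w v = w' v) -> h w = h w'.
  move=> ww'; rewrite /h; congr fine.
  apply: (@measurable_fun_Omega_dep _ (~` [set` L0]) _ _ (fun w => gamma L0 w A)).
  - exact: emeasurable_set1.
  - exact: (measurable_kernel (gamma L0)).
  - by move=> v; rewrite setL0 => /= /eqP; exact: ww'.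
have [g [L gL] hg] := hq _ (divr_gt0 e0 (ltr0Sn R 1)).
exists (h eta0), L => C mC hC.
have mC' : measurable C by exact: measurable_Omega_subset mC.
have hE w : C w -> `|h w - h eta0| <= eps.
  (* [L] may contain [r], where [C] fixes nothing; the kernel does not see the spin at [r], so that
     spin is first reset to its value in [eta0]. *)
  move=> Cw; pose w' v := if v == r then eta0 v else w v.
  have -> : h w = h w' by apply: hr => v /negbTE vr; rewrite /w' vr.
  have gw : g w' = g eta0.
    apply: (measurable_fun_Omega_dep _ gL); first exact: measurable_set1.
    by move=> v /= vL; rewrite /w'; case: eqVneq => // vr; exact: hC.
  have := hg w'; have := hg eta0; rewrite gw !ltr_norml ler_norml.
  by move=> /andP[? ?] /andP[? ?]; apply/andP; split; lra.
have gfin eta : gamma L0 eta A = (h eta)%:E.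
  rewrite /h fineK // ge0_fin_numE ?measure_ge0 //.
  apply: le_lt_trans (ltry 1); rewrite -(prob_kernel (s := gamma L0) eta).
  by apply: le_measure; rewrite ?inE.
have nuAC : nu (A `&` C) = (\int[nu]_(eta in C) gamma L0 eta A)%E.
  rewrite (gc L0); last exact: measurableI.
  rewrite [RHS]integral_mkcond; apply: eq_integral => eta _.
  by apply: proper_kernel_setI => //; rewrite setL0.
have mg : measurable_fun C (fun eta : Config V => gamma L0 eta A).
  apply: measurable_funTS; apply: measurable_fun_Omega_subset.
  exact: (measurable_kernel (gamma L0)).
have h0 eta : 0 <= h eta by exact: fine_ge0.
have cE c : (\int[nu]_(eta in C) cst c%:E eta)%E = (c * fine (nu C))%:E.
  by rewrite integral_cst // EFinM fineK // fin_num_measure.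
have fAC : ((fine (nu (A `&` C)))%:E = \int[nu]_(eta in C) gamma L0 eta A)%E.
  by rewrite -nuAC fineK // fin_num_measure //; exact: measurableI.
apply/andP; split; rewrite -lee_fin fAC.
  rewrite mulrBl EFinB leeBlDr // -!cE -ge0_integralD //=.
  - apply: ge0_le_integral => //=.
    + by move=> w _; rewrite lee_fin.
    + by apply: emeasurable_funD.
    + move=> w Cw; rewrite gfin -EFinD lee_fin.
      by have := hE _ Cw; rewrite ler_norml => /andP[+ _]; lra.
  - by move=> w _; rewrite lee_fin ltW.
rewrite -cE; apply: ge0_le_integral => //=.
move=> w Cw; rewrite gfin lee_fin.
by have := hE _ Cw; rewrite ler_norml => /andP[_]; lra.
Qed.

End QuasilocalApproximation.

(** * The evolved measure on a ball pinned by zeros *)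

Section EvolvedMeasure.
Context (R : realType) (V : choiceType) (e : rel V) (d : nat).
Context (he : cayley_tree e d) (r : V) (beta lambda t : R).
Hypotheses (l0 : 0 < lambda) (t0 : 0 < t).

Local Notation ch := (ch he r).
Local Notation lev := (lev he r).
Local Notation rest := (rest he r).
Local Notation ball := (fun k => r :: rest k).
Local Notation q := (expR (- beta)).

Lemma expR_t_itv : 0 < expR (- (2 * t)) < 1.
Proof. by rewrite expR_gt0 -expR0 ltr_expR oppr_lt0 mulr_gt0. Qed.

Lemma site_kernelE :
  (forall x, site_kernel t x spin_zero = (x == spin_zero)%:R) *
  (site_kernel t spin_zero spin_pos = 0) *
  (site_kernel t spin_zero spin_neg = 0) *
  (site_kernel t spin_pos spin_pos = (1 + expR (- (2 * t))) / 2) *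
  (site_kernel t spin_neg spin_neg = (1 + expR (- (2 * t))) / 2) *
  (site_kernel t spin_pos spin_neg = (1 - expR (- (2 * t))) / 2) *
  (site_kernel t spin_neg spin_pos = (1 - expR (- (2 * t))) / 2).
Proof.
have e1 : (spin_pos == spin_neg) = false by apply/eqP.
have e2 : (spin_neg == spin_pos) = false by apply/eqP.
have e3 : (spin_zero == spin_neg) = false by apply/eqP.
have e4 : (spin_zero == spin_pos) = false by apply/eqP.
have e5 : (spin_pos == spin_zero) = false by apply/eqP.
have e6 : (spin_neg == spin_zero) = false by apply/eqP.
do !split; try (by rewrite /site_kernel ?(e1, e2, e3, e4, e5, e6, eqxx) /=; field).
by case; rewrite /site_kernel ?(e1, e2, e3, e4, e5, e6, eqxx) /=; field.
Qed.

Lemma site_kernel_ge0 x y : 0 <= site_kernel t x y.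
Proof.
have /andP[h0 h1] := expR_t_itv.
by case: y; case: x; rewrite !site_kernelE //; lra.
Qed.

Lemma cfg_sum_pinned (s : seq V) (H : (V -> spin) -> R) w : uniq s ->
  (forall v, v \in s -> w v = spin_zero) ->
  cfg_sum s (fun w => (\prod_(v <- s) (w v == spin_zero)%:R) * H w) w = H w.
Proof.
elim: s w H => [|v s IH] w H /=; first by rewrite big_nil mul1r.
move=> /andP[vs us] w0.
have term x : cfg_sum s (fun w => \prod_(u <- v :: s) (w u == spin_zero)%:R * H w)
    (upd w v x) = (x == spin_zero)%:R * H (upd w v x).
  have h0 u : u \in s -> upd w v x u = spin_zero.
    by move=> us'; rewrite (upd_notin _ _ vs) // w0 // inE us' orbT.
  have := IH _ (fun w => (w v == spin_zero)%:R * H w) us h0; rewrite updE => <-.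
  by apply: eq_cfg_sum => w' hw'; rewrite big_cons -mulrA mulrCA.
rewrite (bigD1 spin_zero) //= term eqxx mul1r big1 ?addr0 => [|x /negbTE x0].
  by rewrite -{1}(w0 v (mem_head v s)) upd_id.
by rewrite term x0 mul0r.
Qed.

Variables (mu nu : probability (Config V) R).
Hypotheses (hmu : wr_gibbs_measure e beta lambda mu) (hnu : time_evolved t mu nu).

Lemma evolved_prob_agree (s : seq V) (zeta w0 : V -> spin) : uniq s ->
  fine (nu (agree s zeta)) = cfg_sum s (fun w =>
    (\prod_(v <- s) site_kernel t (w v) (zeta v)) * fine (mu (agree s w))) w0.
Proof.
case: hnu => K hK hE us.
have mA : measurable (agree s zeta : set (Config V)) by exact: measurable_agree.
rewrite hE //.
transitivity (fine (\int[mu]_(w in setT)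
    (\prod_(v <- s) site_kernel t (w v) (zeta v))%:E)%E).
  congr fine; apply: eq_integral => w _.
  rewrite -cylinder_restrict hK; congr EFin.
  rewrite -(prod_fset_of (fun v => site_kernel t (w v) (zeta v)) us).
  by apply: eq_bigr => i _; rewrite ffunE.
rewrite (@integral_prod_coord _ _ mu s (fun v x => site_kernel t x (zeta v)) setT w0) //.
  by apply: eq_cfg_sum => w _; rewrite setTI.
by move=> v x; exact: site_kernel_ge0.
Qed.

(** Evolved zeros on the sphere force initial zeros there, so [gibbs_ball] applies; the site kernels
    then act as single-site activities. [a] is prescribed on [rest N] only, so it may be continued
    with positive values where [zeta] vanishes. *)
Lemma evolved_prob_ball N : exists2 C : R, 0 < C &
  forall (zeta : V -> spin) (a : V -> spin -> R),
  (forall v, v \in lev N.+1 -> zeta v = spin_zero) ->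
  (forall v x, v \in rest N -> a v x =
    lambda ^ (spin_val x ^+ 2) * site_kernel t x (zeta v)) ->
  fine (nu (agree (ball N.+1) zeta)) =
  C * \sum_x (lambda ^ (spin_val x ^+ 2) * site_kernel t x (zeta r) *
              \prod_(c <- ch r) msg he r q a N c x).
Proof.
have [C C0 hC] := gibbs_ball he r N l0 hmu.
exists C => // zeta a z0 ha; pose o : V -> spin := fun=> spin_zero.
have ub : uniq (ball N.+1) by rewrite /= root_notin_rest uniq_rest.
have bE : ball N.+1 = ball N ++ lev N.+1 by [].
have pE (F : V -> R) : \prod_(v <- ball N.+1) F v =
    (\prod_(v <- ball N) F v) * \prod_(v <- lev N.+1) F v.
  by rewrite bE big_cat.
rewrite (evolved_prob_agree _ o ub).
transitivity (cfg_sum (ball N) (fun w => C * (lambda ^ (spin_val (w r) ^+ 2) *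
    site_kernel t (w r) (zeta r) * tree_weight he r q a N w)) o).
  rewrite [X in cfg_sum X _ _ = _]bE cfg_sum_cat; apply: eq_cfg_sum => w hw.
  have w0 v : v \in lev N.+1 -> w v = spin_zero.
    move=> vl; apply: hw; rewrite mem_ball.
    by move: vl; rewrite mem_lev => /eqP ->; rewrite ltnn.
  rewrite -[RHS](@cfg_sum_pinned (lev N.+1) (fun w => C *
    (lambda ^ (spin_val (w r) ^+ 2) *
     site_kernel t (w r) (zeta r) * tree_weight he r q a N w))) ?uniq_lev //.
  apply: eq_cfg_sum => w' hw'; rewrite pE.
  have -> : \prod_(v <- lev N.+1) site_kernel t (w' v) (zeta v) =
            \prod_(v <- lev N.+1) (w' v == spin_zero)%:R.
    by apply: eq_big_seq => v vl; rewrite z0 // site_kernelE.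
  rewrite -mulrA mulrCA.
  (* Either the initial configuration vanishes on the whole sphere, or both sides are zero. *)
  have [w'0|/allPn[v vl w'v]] := boolP (all (fun v => w' v == spin_zero) (lev N.+1)).
    congr (_ * _); rewrite hC => [|v vl]; last exact/eqP/(allP w'0).
    rewrite /= /ball_weight !big_cons /tree_weight big_split /=.
    have -> : \prod_(v <- rest N) a v (w' v) =
        \prod_(v <- rest N) lambda ^ (spin_val (w' v) ^+ 2) *
        \prod_(v <- rest N) site_kernel t (w' v) (zeta v).
      by rewrite -big_split; apply: eq_big_seq => u us; exact: ha.
    ring.
  suff -> : \prod_(v <- lev N.+1) (w' v == spin_zero)%:R = 0 :> R by rewrite !mul0r.
  by rewrite (big_rem v) //= (negbTE w'v) mul0r.
rewrite mulr_cfg_sumr; congr (_ * _) => /=; apply: eq_bigr => x _.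
transitivity (cfg_sum (rest N) (fun w => lambda ^ (spin_val x ^+ 2) *
    site_kernel t x (zeta r) * tree_weight he r q a N w) (upd o r x)).
  apply: eq_cfg_sum => w hw.
  by rewrite hw ?updE // root_notin_rest.
by rewrite mulr_cfg_sumr cfg_sum_tree_weight updE.
Qed.

Lemma prob_split_coord (B : set (Config V)) : measurable B ->
  fine (nu B) = \sum_x fine (nu ([set w | w r = x] `&` B)).
Proof.
move=> mB; pose o : V -> spin := fun=> spin_zero.
have := @integral_prod_coord _ _ nu [:: r] (fun _ _ => 1) B o isT (fun _ _ => ler01) mB.
under eq_integral do rewrite big1_eq.
rewrite integral_cst // mul1e => ->; rewrite /= .
apply: eq_bigr => x _; rewrite big1_eq mul1r setIC; congr (fine (nu (_ `&` _))).
apply/seteqP; split => w /= => [h|h v].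
  by rewrite h ?mem_head // updE.
by rewrite inE => /eqP ->; rewrite updE.
Qed.

End EvolvedMeasure.

Lemma exists_expr_le (R : realType) (x y : R) : 0 <= x < 1 -> 0 < y ->
  exists K, x ^+ K <= y.
Proof.
move=> /andP[x0 x1] y0.
have /cvgr0Pnorm_le/(_ _ y0) : (fun n => x ^+ n) @ \oo --> (0 : R).
  by apply: cvg_expr; rewrite ger0_norm.
by case=> K _ /(_ K (leqnn K)) h; exists K; apply: le_trans h; exact: ler_norm.
Qed.

(** * Dependence of the root on a distant annulus *)

Section Discontinuity.
Context (R : realType) (V : choiceType) (e : rel V) (d : nat).
Context (he : cayley_tree e d) (r : V) (beta lambda t : R).
Hypotheses (l0 : 0 < lambda) (t0 : 0 < t) (hd : (2 <= d)%N).
Hypotheses (q9 : expR (- beta) <= 9^-1) (E3 : expR (- (2 * t)) <= 3^-1).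

Local Notation ch := (ch he r).
Local Notation depth := (depth he r).
Local Notation rest := (rest he r).
Local Notation q := (expR (- beta)).
Local Notation E := (expR (- (2 * t))).

Variables (mu nu : probability (Config V) R).
Hypotheses (hmu : wr_gibbs_measure e beta lambda mu) (hnu : time_evolved t mu nu).

(* Zero beyond depth [n0 + K]; only the values up to depth [n0 + K + 1] are used. *)
Definition annulus n0 K s v :=
  if (depth v <= n0)%N then spin_pos
  else if (depth v <= n0 + K)%N then s else spin_zero.

(** The spin [s] is continued to all depths beyond [n0], so that the hypotheses on activities hold
    at every vertex; [root_factor] truncates the messages at the outer end of the annulus. *)
Definition local_weight n0 s v x : R := lambda ^ (spin_val x ^+ 2) *
  site_kernel t x (if (depth v <= n0)%N then spin_pos else s).

Definition annulus_event n0 K s : set (Config V) :=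
  agree (rest (n0 + K).+1) (annulus n0 K s).

Definition root_factor n0 K s x : R :=
  \prod_(c <- ch r) msg he r q (local_weight n0 s) (n0 + K) c x.

Lemma annulus_prob n0 K : exists2 C : R, 0 < C & forall s y,
  fine (nu ([set w | w r = y] `&` annulus_event n0 K s)) =
  C * \sum_x (lambda ^ (spin_val x ^+ 2) * site_kernel t x y * root_factor n0 K s x).
Proof.
have [C C0 hC] := evolved_prob_ball he r l0 t0 hmu hnu (n0 + K).
exists C => // s y.
have rR k : r \notin rest k := root_notin_rest he r k.
have -> : [set w | w r = y] `&` annulus_event n0 K s =
    agree (r :: rest (n0 + K).+1) (upd (annulus n0 K s) r y).
  rewrite agree_cons setIC updE; congr (_ `&` _).
  apply/seteqP; split => w /= h v vR.
    by rewrite (upd_notin _ _ (rR _) vR) h.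
  by rewrite h // (upd_notin _ _ (rR _) vR).
have dr v : (0 < depth v)%N -> v != r.
  by apply: contraTneq => ->; rewrite depth_root.
rewrite (hC _ (local_weight n0 s)) ?updE //.
  move=> v; rewrite mem_lev => /eqP dv; rewrite upd_neq ?dr ?dv // /annulus dv.
  by rewrite !ifF //; lia.
move=> v x; rewrite mem_rest => /andP[v0 vN].
by rewrite upd_neq ?dr // /annulus /local_weight vN; case: ifP.
Qed.

Lemma annulus_prob_total n0 K s :
  fine (nu (annulus_event n0 K s)) =
  \sum_y fine (nu ([set w | w r = y] `&` annulus_event n0 K s)).
Proof. by apply: prob_split_coord; exact: measurable_agree. Qed.

Lemma spin_weightE : (lambda ^ (spin_val spin_neg ^+ 2) = lambda) *
  (lambda ^ (spin_val spin_zero ^+ 2) = 1) * (lambda ^ (spin_val spin_pos ^+ 2) = lambda).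
Proof. by rewrite /= sqrrN !expr1n expr0n /= expr0z expr1z. Qed.

(** A nonzero evolved spin excludes an initial zero. The field odds are [(1 + E) / (1 - E)] or the
    inverse, at most 2 because [E <= 3^-1]. *)
Lemma local_weightE n0 s v : s = spin_pos \/ s = spin_neg ->
  [/\ local_weight n0 s v spin_zero = 0,
      0 < local_weight n0 s v spin_neg,
      0 < local_weight n0 s v spin_pos &
      local_weight n0 s v spin_pos <= 2 * local_weight n0 s v spin_neg].
Proof.
move=> hs; have /andP[h0 h1] := expR_t_itv t0; move: E3 => h3.
rewrite /local_weight !spin_weightE.
have -> : site_kernel t spin_zero
    (if (depth v <= n0)%N then spin_pos else s) = 0.
  by case: hs => ->; case: ifP => _; rewrite site_kernelE.
rewrite mulr0; set x := E in h0 h1 h3 *.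
have pp : 0 < lambda * ((1 + x) / 2) by apply: mulr_gt0 => //; lra.
have pm : 0 < lambda * ((1 - x) / 2) by apply: mulr_gt0 => //; lra.
have le1 : lambda * ((1 + x) / 2) <= 2 * (lambda * ((1 - x) / 2)).
  by rewrite [leRHS]mulrCA ler_pM2l //; lra.
have le2 : lambda * ((1 - x) / 2) <= 2 * (lambda * ((1 + x) / 2)).
  by rewrite [leRHS]mulrCA ler_pM2l //; lra.
by case: hs => ->; case: ifP => _; rewrite !site_kernelE.
Qed.

Lemma root_factor_gt0 n0 K s x : s = spin_pos \/ s = spin_neg ->
  0 < root_factor n0 K s x.
Proof.
move=> hs; apply: prodr_gt0 => c _.
by apply: msg_gt0; rewrite ?expR_gt0 // => v; case: (local_weightE n0 v hs).
Qed.

Lemma root_factor_plus n0 K :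
  root_factor n0 K spin_pos spin_neg <= root_factor n0 K spin_pos spin_pos.
Proof.
have hs : spin_pos = spin_pos \/ spin_pos = spin_neg by left.
apply: ler_prod => c _; rewrite ltW /=.
  apply: msg_neg_le_pos; rewrite ?expR_gt0 // => v; try by case: (local_weightE n0 v hs).
  rewrite /local_weight if_same !spin_weightE !site_kernelE.
  by have /andP[h0 h1] := expR_t_itv t0; rewrite ler_pM2l //; lra.
by apply: msg_gt0; rewrite ?expR_gt0 // => v; case: (local_weightE n0 v hs).
Qed.

(** One factor [q] for each of the [d.+1] edges at the root. *)
Lemma root_factor_zero n0 K :
  q ^+ d.+1 * root_factor n0 K spin_neg spin_zero <= root_factor n0 K spin_neg spin_neg.
Proof.
have hs : spin_neg = spin_pos \/ spin_neg = spin_neg by right.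
rewrite -(size_nb he r) -(ch_root he r) -(count_predT (ch r)) -iter_mulr_1.
rewrite -big_const_seq -big_split /=; apply: ler_prod => c _.
apply/andP; split.
  by rewrite mulr_ge0 ?expR_ge0 // ltW // msg_gt0 ?expR_gt0 // => v; case: (local_weightE n0 v hs).
by apply: msg_zero_le; rewrite ?expR_gt0 // => v; case: (local_weightE n0 v hs).
Qed.

(** [K] is the number of levels after which the field alone brings the odds to 1/9; it depends on
    the time only, hence serves every [n0]. *)
Lemma root_factor_minus : exists K, forall n0,
  root_factor n0 K spin_neg spin_pos <= 2^-1 * root_factor n0 K spin_neg spin_neg.
Proof.
have hs : spin_neg = spin_pos \/ spin_neg = spin_neg by right.
have /andP[h0 h1] := expR_t_itv t0.
pose b := (1 + E) / (1 - E).
have b1 : 1 < b by rewrite /b ltr_pdivlMr; lra.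
have bV : 0 <= b^-1 < 1.
  by rewrite invr_ge0 invf_lt1 ?b1 ?andbT ?(lt_trans _ b1) // ltW ?(lt_trans _ b1).
have n9 : 0 < (9^-1 : R) by rewrite invr_gt0.
have [K hK] := exists_expr_le bV n9.
exists K => n0; have q0 : 0 < q by exact: expR_gt0.
have lw v := local_weightE n0 v hs.
have an v : 0 < local_weight n0 spin_neg v spin_neg by case: (lw v).
have ap v : 0 < local_weight n0 spin_neg v spin_pos by case: (lw v).
have a0 v : local_weight n0 spin_neg v spin_zero = 0 by case: (lw v).
have [m0 m1] : 0 <= odds_map q 9^-1 /\ odds_map q 9^-1 <= 2^-1.
  have /andP[m0 _] : 0 <= odds_map q 9^-1 <= 1.
    by apply: odds_map_itv => //; apply/andP; split; lra.
  (* The square of [odds_map q 9^-1] is at most 1/18, below 1/4. One child of the root then suffices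
     for the factor 1/2. *)
  split => //; have := odds_map_ninth q0 q9; rewrite expr2; nra.
rewrite /root_factor -[X in X * _]expr1; apply: prodr_le_expr.
- by apply/andP; split; lra.
- by rewrite ch_root (size_nb he).
- move=> c cr; rewrite ltW ?msg_gt0 //=.
  have cr0 : c != r by apply/eqP => cE; move: (depth_ch cr); rewrite cE depth_root.
  have dc : depth c = 1%N by rewrite (depth_ch cr) depth_root.
  apply: (@le_trans _ _ (odds_map q 9^-1 *
    msg he r q (local_weight n0 spin_neg) (n0 + K) c spin_neg)); last first.
    by rewrite ler_wpM2r // ltW ?msg_gt0.
  apply: (@msg_interior _ _ _ _ he r q _ q0 q9 hd a0 an ap n0 b b1 _ _ K) => //.
  + move=> v dv; rewrite /local_weight leqNgt dv /= !spin_weightE !site_kernelE.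
    rewrite (_ : b^-1 * _ = lambda * ((1 - E) / 2)) // /b.
    by field; rewrite !gt_eqF //; lra.
  + by move=> v; case: (lw v).
  + by rewrite dc.
  + by rewrite dc addn1 addSn.
- by move=> c; rewrite ltW ?msg_gt0.
Qed.

Lemma measurable_annulus_event n0 K s :
  measurable (annulus_event n0 K s : set (Omega (~` [set r]))).
Proof.
by apply: measurable_agree => v vR /= vr; move: vR; rewrite vr (negbTE (root_notin_rest he r _)).
Qed.

Lemma evolved_discontinuity : exists2 delta : R, 0 < delta &
  exists K, forall n0,
  [/\ 0 < fine (nu (annulus_event n0 K spin_pos)),
      0 < fine (nu (annulus_event n0 K spin_neg)),
      fine (nu ([set w | w r = spin_neg] `&` annulus_event n0 K spin_pos)) <=
      fine (nu ([set w | w r = spin_pos] `&` annulus_event n0 K spin_pos)) &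
      fine (nu ([set w | w r = spin_pos] `&` annulus_event n0 K spin_neg)) +
      delta * fine (nu (annulus_event n0 K spin_neg)) <=
      fine (nu ([set w | w r = spin_neg] `&` annulus_event n0 K spin_neg))].
Proof.
have /andP[h0 h1] := expR_t_itv t0.
have q0 : 0 < q ^+ d.+1 by rewrite exprn_gt0 ?expR_gt0.
set Q := q ^+ d.+1 in q0.
have D0 : 0 < 2 * lambda * Q + 1 by rewrite addr_gt0 // !mulr_gt0.
(* With [B], [B0], [B1] the factors of the minus annulus at root spin minus, zero, plus, the gap in
   conditional probability is [lambda * E * (B - B1) / (lambda * B + B0 + lambda * B1)]. Inserting
   [B1 <= B / 2] and [B0 <= B / Q] gives this bound. *)
exists (lambda * E * Q / 2 / (2 * lambda * Q + 1)).
  by rewrite !mulr_gt0 ?invr_gt0.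
have [K hK] := root_factor_minus; exists K => n0.
have [C C0 hC] := annulus_prob n0 K.
rewrite !annulus_prob_total !sum_spin !hC !sum_spin !spin_weightE !site_kernelE.
have e1 : (spin_neg == spin_zero) = false by apply/eqP.
have e2 : (spin_pos == spin_zero) = false by apply/eqP.
rewrite e1 e2 eqxx /=.
have hp x : 0 < root_factor n0 K spin_pos x by apply: root_factor_gt0; left.
have hn x : 0 < root_factor n0 K spin_neg x by apply: root_factor_gt0; right.
have hplus := root_factor_plus n0 K.
have hzero := root_factor_zero n0 K.
have hminus := hK n0.
move: (hp spin_neg) (hp spin_zero) (hp spin_pos) (hn spin_neg) (hn spin_zero)
  (hn spin_pos) hplus hzero hminus.
set A := root_factor _ _ _ _; set A0 := root_factor _ _ _ _.
set A1 := root_factor _ _ _ _.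
set B := root_factor _ _ _ _; set B0 := root_factor _ _ _ _.
set B1 := root_factor _ _ _ _; rewrite -/Q.
move=> pA pA0 pA1 pB pB0 pB1 AA BB0 BB1.
have tot (X Y Z : R) : C * (lambda * ((1 + E) / 2) * X + 1 * 0 * Y + lambda * ((1 - E) / 2) * Z)
  + C * (lambda * 0 * X + 1 * 1 * Y + lambda * 0 * Z) +
  C * (lambda * ((1 - E) / 2) * X + 1 * 0 * Y + lambda * ((1 + E) / 2) * Z) =
  C * (lambda * X + Y + lambda * Z) by field.
rewrite !tot; split.
- by rewrite mulr_gt0 // !addr_gt0 ?mulr_gt0.
- by rewrite mulr_gt0 // !addr_gt0 ?mulr_gt0.
- rewrite ler_pM2l // -subr_ge0.
  rewrite (_ : _ - _ = lambda * E * (A1 - A)); last by field.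
  by rewrite mulr_ge0 ?subr_ge0 // ltW // mulr_gt0.
- rewrite [_ * (C * _)]mulrCA -mulrDr ler_pM2l // -lerBrDl.
  rewrite [leRHS](_ : _ = lambda * E * (B - B1)); last by field.
  rewrite mulrAC ler_pdivrMr //.
  have lE : 0 < lambda * E by rewrite mulr_gt0.
  rewrite -!(mulrA (lambda * E)) ler_pM2l //.
  apply: (@le_trans _ _ (B / 2 * (2 * lambda * Q + 1))); last first.
    by rewrite ler_pM2r //; lra.
  have h : lambda * Q * B1 <= lambda * Q * B by rewrite ler_pM2l ?mulr_gt0 //; lra.
  nra.
Qed.

End Discontinuity.

(** * Contradiction with quasilocality *)

Theorem mainTheorem4 (R : realType) (d : nat) (hd : (2 <= d)%N)
    (V : choiceType) (e : rel V) (he : cayley_tree e d) :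
  exists beta_c : R, 0 < beta_c /\
    forall beta : R, beta_c < beta ->
    exists t_c : R, 0 < t_c /\
      forall t : R, t_c <= t ->
      forall lambda : R, 0 < lambda ->
      forall mu mu_t : probability (Config V) R,
        intermediate_measure e beta lambda mu ->
        time_evolved t mu mu_t ->
        ~ gibbs_measure mu_t.
Proof.
exists 8; split => // beta hbeta; exists 1; split => // t ht lambda l0 mu nu.
move=> [hmu _ _ _] hnu [gamma [[gp _] gq gc]].
have [r _] : exists r : V, [set: V] r.
  apply/set0P/eqP => V0; case: he => _ _ _ + _; rewrite V0; apply.
  exact: finite_set0.
have t0 : 0 < t by apply: lt_le_trans ht.
(* The bound [1 + x <= expR x] turns [beta > 8] into 9 here and [t >= 1] into 3 below. *)
have q9 : expR (- beta) <= 9^-1.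
  rewrite expRN lef_pV2 ?posrE ?expR_gt0 //.
  by apply: le_trans (expR_ge1Dx beta); lra.
have E3 : expR (- (2 * t)) <= 3^-1.
  rewrite expRN lef_pV2 ?posrE ?expR_gt0 //.
  by apply: le_trans (expR_ge1Dx (2 * t)); lra.
have [delta delta0 [K hK]] := evolved_discontinuity he r l0 t0 hd q9 E3 hmu hnu.
(* The plus annulus gives [p2 <= p1 + 2 eps] and the minus annulus [p1 + delta <= p2 + 2 eps], so
   any [eps] below [delta / 4] is contradictory. *)
have eps0 : 0 < delta / 5 by rewrite divr_gt0.
have [p1 [L1 h1]] := quasilocal_approx gp gq gc r spin_pos (fun=> spin_pos) eps0.
have [p2 [L2 h2]] := quasilocal_approx gp gq gc r spin_neg (fun=> spin_pos) eps0.
have [n1 hn1] := exists_ball he r L1; have [n2 hn2] := exists_ball he r L2.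
(* The inner plus ball covers both local sets, so the two annulus events agree there. *)
pose n0 := maxn n1 n2.
have hC s (L : {fset V}) n : (n <= n0)%N -> (forall v, v \in L -> (depth he r v <= n)%N) ->
    forall w, annulus_event he r n0 K s w -> forall v, v \in L -> v != r -> w v = spin_pos.
  move=> nn0 hL w hw v vL vr; have dv : (depth he r v <= n0)%N.
    exact: leq_trans (hL v vL) nn0.
  rewrite hw /annulus ?dv // mem_rest (depth_gt0 he vr) /=; lia.
have hC1 s := hC s L1 n1 (leq_maxl _ _) hn1.
have hC2 s := hC s L2 n2 (leq_maxr _ _) hn2.
have mC s : measurable (annulus_event he r n0 K s : set (Omega (~` [set r]))).
  exact: measurable_annulus_event.
have [pp pm ineq_p ineq_m] := hK n0.
have /andP[_ a1] := h1 _ (mC spin_pos) (hC1 spin_pos).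
have /andP[a2 _] := h2 _ (mC spin_pos) (hC2 spin_pos).
have /andP[b1 _] := h1 _ (mC spin_neg) (hC1 spin_neg).
have /andP[_ b2] := h2 _ (mC spin_neg) (hC2 spin_neg).
have c1 : p2 - delta / 5 <= p1 + delta / 5.
  by rewrite -(ler_pM2r pp); apply: le_trans a2 (le_trans ineq_p a1).
have c2 : p1 - delta / 5 + delta <= p2 + delta / 5.
  rewrite -(ler_pM2r pm); apply: le_trans b2; apply: le_trans ineq_m.
  by rewrite mulrDl lerD2r.
lra.
Qed.
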